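(* Let $\Delta$ be a positive integer that is not a square and let $\omega\in\mathscr X(\Delta)$. The following are equivalent: (i) $\omega\in\mathscr R_E(\Delta)$; (ii) $\omega>1$ and the ECF expansion of $\omega$ is (purely) periodic, i.e. $\omega=[\,\overline{(a_1,e_1),\ldots,(a_n,e_n)}\,]$ for some $n\ge1$; (iii) $\omega>1$ and $\omega$ is a periodic point of the map $T_E$, i.e. $T_E^n(\omega)=\omega$ for some $n\ge1$.
   Context: A quadratic irrational (QI) is a real number of degree 2 over $\mathbb Q$; $\omega^*$ is its Galois conjugate, and $\operatorname{disc}(\omega)=B^2-4AC$ where $AX^2+BX+C$ is the minimal polynomial of $\omega$ with $A,B,C\in\mathbb Z$, $A>0$, $\gcd(A,B,C)=1$. $\mathscr X(\Delta)$ is the set of QIs of discriminant $\Delta$, and $\mathscr R_E(\Delta)$ is the set of $\omega\in\mathscr X(\Delta)$ with $\omega>1$ and $-1<\omega^*<1$ ($E$-reduced QIs). Every irrational $u>1$ has a unique even continued fraction (ECF) expansion $u=[(a_1,e_1),(a_2,e_2),\ldots]:=a_1+\cfrac{e_1}{a_2+\cfrac{e_2}{a_3+\cdots}}$ with $a_i$ positive even integers and $e_i\in\{\pm1\}$. The ECF Gauss shift $T_E$ on $[1,\infty)\setminus\mathbb Q$ is $T_E(u)=\frac{e_1}{u-a_1}$, where $a_1=2\lfloor\frac{u+1}{2}\rfloor$ and $e_1=\operatorname{sgn}(u-a_1)$; it acts by $T_E([(a_1,e_1),(a_2,e_2),\ldots])=[(a_2,e_2),(a_3,e_3),\ldots]$.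 *)

(* Defs.v *)
From HB Require Import structures.
From mathcomp Require Import all_boot all_order all_algebra.
From mathcomp Require Import all_classical all_reals all_analysis.

Set Implicit Arguments.
Unset Strict Implicit.
Unset Printing Implicit Defensive.

Import Order.TTheory GRing.Theory Num.Theory.
Import numFieldNormedType.Exports.

Local Open Scope classical_set_scope.
Local Open Scope ring_scope.

Definition has_degree (R : realType) (w : R) (d : nat) : Prop :=
  (exists p : {poly rat},
     [/\ p != 0, root (map_poly ratr p) w & size p = d.+1]) /\
  (forall q : {poly rat},
     q != 0 -> root (map_poly ratr q) w -> (d < size q)%N).

Definition QI (R : realType) (w : R) : Prop := has_degree w 2.

(* As [w] has degree 2, a primitive integral quadratic polynomial vanishing at
   [w] is, up to a rational factor, the minimal polynomial of [w] over Q; the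
   condition [0 < A] makes [A, B, C] unique. *)
Definition qi_minpoly (R : realType) (w : R) (A B C : int) : Prop :=
  [/\ QI w, 0 < A, gcdz A (gcdz B C) = 1 &
      A%:~R * w ^+ 2 + B%:~R * w + C%:~R = 0].

Definition qi_of_disc (R : realType) (D : nat) (w : R) : Prop :=
  exists A B C : int, qi_minpoly w A B C /\ B ^+ 2 - 4 * A * C = D%:Z.

(* [w'] is the Galois conjugate of [w]: the other root of the minimal
   polynomial of [w]. That root exists, is unique, and is real since [w] is. *)
Definition qi_conj (R : realType) (w w' : R) : Prop :=
  exists A B C : int,
    [/\ qi_minpoly w A B C,
        A%:~R * w' ^+ 2 + B%:~R * w' + C%:~R = 0 & w' != w].

Definition E_reduced (R : realType) (D : nat) (w : R) : Prop :=
  [/\ qi_of_disc D w, 1 < w & exists2 w' : R, qi_conj w w' & -1 < w' < 1].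

(* [ecf_trunc R s n k] is the finite continued fraction
     a_k + e_k / (a_(k+1) + e_(k+1) / (... + e_(k+n-1) / a_(k+n)))
   where [s i = (a_i, e_i)], indices starting at 0. When every a_i is at least 2
   and every e_i is 1 or -1, all the denominators are greater than 1. *)
Fixpoint ecf_trunc (R : realType) (s : nat -> nat * int) (n k : nat) : R :=
  if n is n'.+1 then (s k).1%:R + (s k).2%:~R / ecf_trunc R s n' k.+1
  else (s k).1%:R.

Definition ecf_expansion (R : realType) (u : R) (s : nat -> nat * int) : Prop :=
  (forall i, [/\ (0 < (s i).1)%N, ~~ odd (s i).1 &
                 (s i).2 = 1 \/ (s i).2 = -1]) /\
  (fun n => ecf_trunc R s n 0) @ \oo --> u.

Definition purely_periodic (T : Type) (s : nat -> T) : Prop :=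
  exists2 n : nat, (0 < n)%N & forall i, s (i + n)%N = s i.

Definition ecf_digit (R : realType) (u : R) : int :=
  2 * Num.floor ((u + 1) / 2).

(* Meant for irrational [u >= 1], a set that it maps to itself; there
   [u - ecf_digit u] is nonzero. *)
Definition T_E (R : realType) (u : R) : R :=
  Num.sg (u - (ecf_digit u)%:~R) / (u - (ecf_digit u)%:~R).

(* Main.v *)
(* T_E acts on a quadratic irrational u and its conjugate v simultaneously by
   x |-> e / (x - a), where a and e are the first ECF digits of u. This action
   preserves the discriminant, maps the region u > 1, |v| < 1 into itself, and is
   injective there because the image of v determines a and e. The region contains
   finitely many pairs of a given discriminant, so E-reduced numbers are periodic
   under T_E. Conversely, if u is periodic and |v| > 1, then |v| > 1 along the
   whole orbit; hence |u - a| and |v - a| stay below 1 and |u - v| strictly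
   increases at each step, contradicting periodicity. *)

Require Import Defs.
From HB Require Import structures.
From mathcomp Require Import all_boot all_order all_algebra.
From mathcomp Require Import all_classical all_reals all_analysis.
From mathcomp Require Import zify ring lra.

Set Implicit Arguments.
Unset Strict Implicit.
Unset Printing Implicit Defensive.

Import Order.TTheory GRing.Theory Num.Theory.
Import numFieldNormedType.Exports.

Local Open Scope ring_scope.

(** * Irrationality and its stability under x |-> e / (x - a) *)

(** Stated as an integral linear relation so that relations between quadratic equations turn
    directly into equalities of integer coefficients. *)
Definition irrat (R : realType) (u : R) : Prop :=
  forall p q : int, p%:~R * u + q%:~R = 0 -> p = 0.

Lemma irrat_neq_int (R : realType) (u : R) (a : int) : irrat u -> u != a%:~R.
Proof.
move=> iu; apply/eqP => ua.
suff : (1 : int) = 0 by [].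
by apply: (iu 1 (- a)); rewrite ua rmorphN mul1r subrr.
Qed.

Lemma QI_irrat (R : realType) (u : R) : QI u -> irrat u.
Proof.
move=> [_ deg] p q pq0; apply/eqP/negPn/negP => p0.
pose P : {poly rat} := p%:~R *: 'X + (q%:~R)%:P.
have sizeP : size P = 2%N.
  rewrite /P size_polyDl ?size_scale ?size_polyX ?intr_eq0 //.
  by rewrite size_polyC; case: (_ != _).
have P0 : P != 0 by rewrite -size_poly_eq0 sizeP.
have := deg P P0; rewrite sizeP => /(_ _)/wrap[] //.
rewrite /root /P rmorphD /= map_polyZ map_polyX map_polyC /= !ratr_int.
by rewrite !hornerE pq0.
Qed.

(** Multiplying a relation for the image by [u - a] gives one for [u] with leading coefficient [q];
    so [q = 0], and then [p * e = 0]. *)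
Lemma irrat_inv_sub (R : realType) (u : R) (a e : int) : irrat u -> e ^+ 2 = 1 ->
  irrat (e%:~R / (u - a%:~R)).
Proof.
move=> iu e1 p q pq0.
have ua : u - a%:~R != 0 by rewrite subr_eq0 irrat_neq_int.
have := pq0 => /(congr1 ( *%R^~ (u - a%:~R))).
rewrite mul0r mulrDl -mulrA divfK // => pq1.
have q0 : q = 0.
  apply: (iu q (p * e - q * a)).
  by rewrite -pq1 rmorphB !rmorphM /=; ring.
move: pq1; rewrite q0 mul0r addr0 -rmorphM /= => /eqP.
rewrite intr_eq0 mulf_eq0 => /orP[/eqP//|/eqP e0].
by rewrite e0 expr0n in e1.
Qed.

(** * ECF digits and the Gauss shift *)

Lemma even_dist_lt2 (k l : int) : `|2 * k - 2 * l| < 2 -> k = l.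
Proof. lia. Qed.

Lemma ecf_digit_dist (R : realType) (u : R) :
  irrat u -> `|u - (ecf_digit u)%:~R| < 1.
Proof.
move=> iu; rewrite /ecf_digit; set k := Num.floor _.
have /andP[] := mem_rg1_floor ((u + 1) / 2); rewrite -/k => h1 h2.
(* The floor only gives [2 * k - 1 <= u]; irrationality makes this strict. *)
have h : u - (2 * k - 1)%:~R != 0 by rewrite subr_eq0 irrat_neq_int.
have hk : 0 < u - (2 * k - 1)%:~R.
  by rewrite lt_def h /= rmorphB rmorphM /=; lra.
by move: hk; rewrite rmorphB rmorphM /= ltr_norml => hk; apply/andP; split; lra.
Qed.

Lemma ecf_digitE (R : realType) (u : R) (k : int) :
  `|u - (2 * k)%:~R| < 1 -> ecf_digit u = 2 * k.
Proof.
rewrite ltr_norml rmorphM /= => /andP[h1 h2]; congr (2 * _).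
by apply: Num.Theory.floor_def; rewrite rmorphD /=; apply/andP; split; lra.
Qed.

Lemma ecf_digit_gt1 (R : realType) (u : R) : 1 < u -> 2 <= ecf_digit u.
Proof.
move=> u1; rewrite /ecf_digit -[X in X <= _]mulr1 ler_pM2l //.
by rewrite floor_ge_int /=; lra.
Qed.

Definition ecf_sign (R : realType) (u : R) : int := sgz (u - (ecf_digit u)%:~R).

Lemma ecf_sign_sqr (R : realType) (u : R) : irrat u -> ecf_sign u ^+ 2 = 1.
Proof.
by move=> iu; rewrite /ecf_sign sgz_odd ?subr_eq0 ?irrat_neq_int.
Qed.

Lemma T_EE (R : realType) (u : R) :
  T_E u = (ecf_sign u)%:~R / (u - (ecf_digit u)%:~R).
Proof. by rewrite /T_E /ecf_sign sgrEz. Qed.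

Lemma T_E_norm (R : realType) (u : R) :
  T_E u = `|u - (ecf_digit u)%:~R|^-1.
Proof.
rewrite /T_E; set x := u - _; case: (sgrP x) => [->|h|h]; rewrite ?invr0 ?mulr0 ?mul1r //.
by rewrite mulN1r invrN.
Qed.

Lemma T_E_irrat (R : realType) (u : R) : irrat u -> irrat (T_E u).
Proof. by move=> iu; rewrite T_EE; apply/irrat_inv_sub/ecf_sign_sqr. Qed.

Lemma T_E_gt1 (R : realType) (u : R) : irrat u -> 1 < T_E u.
Proof.
move=> iu; rewrite T_E_norm invf_gt1 ?ecf_digit_dist //.
by rewrite normr_gt0 subr_eq0 irrat_neq_int.
Qed.

(** As [u1 > 1], the even integer [2 * k] is within distance 1 of [u], hence is its digit; the sign
    drops out because [T_E u] is the inverse of a norm and [u1 > 0]. *)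
Lemma T_E_def (R : realType) (u u1 : R) (k e : int) : e = 1 \/ e = -1 ->
  1 < u1 -> u1 = e%:~R / (u - (2 * k)%:~R) -> T_E u = u1.
Proof.
move=> e1 u1_gt1 u1E.
have nE : u1 = `|u - (2 * k)%:~R|^-1.
  rewrite -[LHS]ger0_norm ?ltW ?(lt_trans _ u1_gt1) // u1E normrM normfV.
  by case: e1 => ->; rewrite ?rmorphN ?normrN normr1 mul1r.
have n1 : `|u - (2 * k)%:~R| < 1.
  by rewrite -[X in X < _]invrK -nE invf_lt1 // (lt_trans _ u1_gt1).
by rewrite T_E_norm (ecf_digitE n1).
Qed.

Lemma iter_T_E_irrat_gt1 (R : realType) (u : R) (n : nat) :
  irrat u -> 1 < u -> irrat (iter n (@T_E R) u) /\ 1 < iter n (@T_E R) u.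
Proof.
move=> iu u1; elim: n => //= n [in1 _].
by split; [apply: T_E_irrat | apply: T_E_gt1].
Qed.

(** * Convergence of truncations, and the shift on expansions *)

Definition ecf_digits (s : nat -> nat * int) : Prop :=
  forall i, [/\ (0 < (s i).1)%N, ~~ odd (s i).1 & (s i).2 = 1 \/ (s i).2 = -1].

(** The extremal case has all digits [(2, -1)] and attains equality, since 2 - 1 / (1 + 1 / (n + 1))
    = 1 + 1 / (n + 2). *)
Lemma ecf_trunc_ge (R : realType) (s : nat -> nat * int) (n k : nat) :
  ecf_digits s -> 1 + n.+1%:R^-1 <= ecf_trunc R s n k.
Proof.
move=> sP; elim: n k => [|n IHn] k /=; have [a0 ao e1] := sP k;
  have a2 : 2 <= (s k).1%:R :> R by rewrite ler_nat; lia.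
  by rewrite invr1; lra.
have := IHn k.+1; set t := ecf_trunc _ _ _ _ => tge.
have n0 : 0 < n.+1%:R :> R by rewrite ltr0n.
have tinv : 1 - n.+2%:R^-1 >= t^-1.
  have -> : 1 - n.+2%:R^-1 = (1 + n.+1%:R^-1)^-1 :> R.
    by rewrite -[n.+2%:R]natr1; field; rewrite ?nat1r ?natr1 !pnatr_eq0.
  by rewrite lef_pV2 ?posrE // ?(lt_le_trans _ tge) // addr_gt0 ?invr_gt0.
have t0 : 0 <= t^-1.
  by rewrite invr_ge0 (le_trans _ tge) // addr_ge0 ?invr_ge0 ?ltW.
have {}e1 : (s k).2%:~R * t^-1 = t^-1 \/ (s k).2%:~R * t^-1 = - t^-1.
  by case: e1 => ->; [left; rewrite mul1r | right; rewrite mulN1r].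
move: (t^-1) (n.+2%:R^-1 : R) ((s k).1%:R : R) (_ * _) e1 t0 tinv a2 =>
  x y a z.
by case=> ->; lra.

Qed.

(* The tails of the expansion may come arbitrarily close to 1, so one step is not
   uniformly contracting; but the n-th truncation stays above 1 + 1 / (n + 1), and
   the resulting contraction factors telescope to 1 / (n + 1). *)
Lemma ecf_trunc_dist (R : realType) (s : nat -> nat * int) (u : nat -> R) :
  ecf_digits s -> (forall k, 1 < u k) ->
  (forall k, u k = (s k).1%:R + (s k).2%:~R / u k.+1) ->
  forall n k, `|ecf_trunc R s n k - u k| <= n.+1%:R^-1.
Proof.
move=> sP u1 uS; elim=> [|n IHn] k /=; rewrite [u k]uS;
  have u0 : 0 < u k.+1 := lt_trans ltr01 (u1 k.+1);
  have [_ _ e1] := sP k;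
  have ne x : `|(s k).2%:~R * x| = `|x| :> R
    by case: e1 => ->; rewrite normrM ?rmorphN ?normrN normr1 mul1r.
  rewrite opprD addrA subrr sub0r normrN ne normfV gtr0_norm // invr1.
  by rewrite invf_le1 // ltW.
rewrite opprD addrACA subrr add0r -mulrBr ne.
have := IHn k.+1; have := ecf_trunc_ge R n k.+1 sP.
set t := ecf_trunc _ _ _ _ => tge tu.
have n0 : 0 < n.+1%:R :> R by rewrite ltr0n.
have c0 : 0 < 1 + n.+1%:R^-1 :> R by rewrite addr_gt0 ?invr_gt0.
have t0 : 0 < t := lt_le_trans c0 tge.
have -> : t^-1 - (u k.+1)^-1 = - (t - u k.+1) / (t * u k.+1).
  by field; rewrite !gt_eqF.
rewrite normrM normrN normfV [`|t * _|]gtr0_norm ?mulr_gt0 //.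
rewrite ler_pdivrMr ?mulr_gt0 //; apply: le_trans tu _.
have -> : n.+1%:R^-1 = n.+2%:R^-1 * (1 + n.+1%:R^-1) :> R.
  by rewrite -[n.+2%:R]natr1; field; rewrite ?nat1r ?natr1 !pnatr_eq0.
rewrite ler_pM2l ?invr_gt0 ?ltr0n //.
by apply: le_trans tge _; rewrite ler_peMr // ltW.
Qed.

Definition ecf_seq (R : realType) (u : R) (i : nat) : nat * int :=
  (`|ecf_digit (iter i (@T_E R) u)|%N, ecf_sign (iter i (@T_E R) u)).

Lemma ecf_seq_expansion (R : realType) (u : R) : irrat u -> 1 < u ->
  ecf_expansion u (ecf_seq u).
Proof.
move=> iu u1; pose x i := iter i (@T_E R) u.
have xP i : irrat (x i) /\ 1 < x i by apply: iter_T_E_irrat_gt1.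
have sP : ecf_digits (ecf_seq u).
  move=> i; have [ix x1] := xP i; rewrite /ecf_seq /= -/(x i).
  have d2 := ecf_digit_gt1 x1.
  split; first by lia.
    by rewrite /ecf_digit abszM oddM.
  by have /eqP := ecf_sign_sqr ix; rewrite sqrf_eq1 => /orP[]/eqP; [left|right].
split => //.
have xS k : x k = (ecf_seq u k).1%:R + (ecf_seq u k).2%:~R / x k.+1.
  have [ix x1] := xP k; rewrite /= -/(x k) natr_absz ger0_norm; last first.
    by apply: le_trans (ecf_digit_gt1 x1).
  have x0 : x k - (ecf_digit (x k))%:~R != 0 by rewrite subr_eq0 irrat_neq_int.
  have e0 : (ecf_sign (x k))%:~R != 0 :> R.
    by rewrite intr_eq0 /ecf_sign sgz_eq0.
  by rewrite -/(x k) T_EE invf_div mulrCA divff // mulr1 addrC subrK.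
apply/cvgrPdist_le => eps eps0; near=> n.
rewrite distrC; apply: le_trans (ecf_trunc_dist sP (fun k => (xP k).2) xS n 0) _.
by apply: ltW; near: n; exact: (near_infty_natSinv_lt (PosNum eps0)).
Unshelve. all: by end_near. Qed.

(** Solving one level of the truncation for its tail and passing to the limit shows that the tails
    converge to [e / (x - a)]; this limit exceeds 1, so it is [T_E x]. In particular any expansion
    of [u] is governed by the orbit of [u]. *)
Lemma ecf_expansion_iter (R : realType) (u : R) (s : nat -> nat * int) :
  irrat u -> ecf_expansion u s ->
  forall k, ((fun n => ecf_trunc R s n k) @ \oo --> iter k (@T_E R) u)%classic.
Proof.
move=> iu [sP su] k.
suff [] : irrat (iter k (@T_E R) u) /\
  ((fun n => ecf_trunc R s n k) @ \oo --> iter k (@T_E R) u)%classic by [].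
elim: k => //= k [ix xk]; set x := iter k _ u in ix xk *.
have [a0 ao e1] := sP k.
have [m aE] : exists m : int, (s k).1%:R = (2 * m)%:~R :> R.
  exists ((s k).1./2%:Z).
  rewrite -{1}[(s k).1]odd_double_half (negbTE ao) add0n -mul2n.
  by rewrite natrM rmorphM.
have e2 : (s k).2 ^+ 2 = 1 by case: e1 => ->.
have xa : x - (2 * m)%:~R != 0 by rewrite subr_eq0 irrat_neq_int.
pose y : R := (s k).2%:~R / (x - (2 * m)%:~R).
have iy : irrat y by apply: irrat_inv_sub.
have ycv : ((fun n => ecf_trunc R s n k.+1) @ \oo --> y)%classic.
  have -> : (fun n => ecf_trunc R s n k.+1) =
      (fun n => (s k).2%:~R / (ecf_trunc R s n.+1 k - (2 * m)%:~R)).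
    apply/funext => n /=; rewrite aE addrC addKr invf_div mulrCA.
    by rewrite divff ?mulr1 // intr_eq0 -sqrf_eq0 e2.
  apply: cvgM; first exact: cvg_cst.
  apply: cvgV => //; apply: cvgB; last exact: cvg_cst.
  by have := xk; rewrite -(cvg_shiftS (fun n => ecf_trunc R s n k)).
(* The lower bounds on truncations tend to 1, so the limit only satisfies [1 <= y]; irrationality
   excludes equality. *)
have y1 : 1 < y.
  have : 1 <= y.
    rewrite -(cvg_lim _ ycv) //; apply: limr_ge; first by apply/cvg_ex; exists y.
    near=> n; apply: le_trans (ecf_trunc_ge R n k.+1 sP).
    by rewrite lerDl.
  by rewrite le_eqVlt eq_sym (negbTE (irrat_neq_int 1 iy)).
have -> : T_E x = y by apply: (T_E_def e1 y1).
by split.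
Unshelve. all: by end_near. Qed.

(** * Pairs of conjugate roots of an integral quadratic polynomial *)

(* [A], [B], [C] need not be coprime and [A] may be negative: only the discriminant
   [D] matters, and both conditions would have to be maintained along orbits. *)
Definition conj_roots (R : realType) (D A B C : int) (u v : R) : Prop :=
  [/\ B ^+ 2 - 4 * A * C = D,
      A%:~R * u ^+ 2 + B%:~R * u + C%:~R = 0,
      A%:~R * v ^+ 2 + B%:~R * v + C%:~R = 0 & u != v].

Lemma conj_roots_sum (R : realType) (D A B C : int) (u v : R) :
  conj_roots D A B C u v -> B%:~R = - (A%:~R * (u + v)).
Proof.
move=> [_ ru rv uv]; apply/eqP; rewrite -addr_eq0.
have /mulfI : u - v != 0 by rewrite subr_eq0.
move/inj_eq => /(_ _ 0) <-; rewrite mulr0; apply/eqP.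
by transitivity (A%:~R * u ^+ 2 + B%:~R * u + C%:~R -
  (A%:~R * v ^+ 2 + B%:~R * v + C%:~R)); [ring | rewrite ru rv subrr].
Qed.

Lemma conj_roots_prod (R : realType) (D A B C : int) (u v : R) :
  conj_roots D A B C u v -> C%:~R = A%:~R * (u * v).
Proof.
move=> h; have Bs := conj_roots_sum h; have [_ ru _ _] := h.
by move: ru; rewrite Bs => /eqP; rewrite addrC addr_eq0 => /eqP ->; ring.
Qed.

Lemma conj_roots_lead_neq0 (R : realType) (D A B C : int) (u v : R) :
  irrat u -> D != 0 -> conj_roots D A B C u v -> A != 0.
Proof.
move=> iu D0 [DE ru _ _]; apply: contraNneq D0 => A0.
rewrite -DE A0 mulr0 mul0r subr0; apply/eqP.
by rewrite (iu B C) ?expr0n //; move: ru; rewrite A0 mul0r add0r.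
Qed.

(** Substituting [A v = - B - A u] turns a relation for [v] into one for [u] with leading
    coefficient [p * A]. *)
Lemma conj_roots_irrat (R : realType) (D A B C : int) (u v : R) :
  irrat u -> D != 0 -> conj_roots D A B C u v -> irrat v.
Proof.
move=> iu D0 h p q pq0; have A0 := conj_roots_lead_neq0 iu D0 h.
have Bs := conj_roots_sum h.
have /eqP : p * A = 0.
  apply: (iu _ (p * B - A * q)); rewrite rmorphB !rmorphM /= Bs.
  by transitivity (- A%:~R * (p%:~R * v + q%:~R)); [ring | rewrite pq0 mulr0].
by rewrite mulf_eq0 (negbTE A0) orbF => /eqP.
Qed.

(** Eliminating the square of [u] leaves a linear relation, so [A * B' = A' * B] and both
    polynomials have the same sum of roots. *)
Lemma conj_roots_uniq (R : realType) (D D' A B C A' B' C' : int) (u v v' : R) :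
  irrat u -> D != 0 -> D' != 0 ->
  conj_roots D A B C u v -> conj_roots D' A' B' C' u v' -> v = v'.
Proof.
move=> iu D0 D0' h h'.
have A0 := conj_roots_lead_neq0 iu D0 h.
have A0' := conj_roots_lead_neq0 iu D0' h'.
have Bs := conj_roots_sum h; have Bs' := conj_roots_sum h'.
have [_ ru _ _] := h; have [_ ru' _ _] := h'.
have : A * B' - A' * B = 0.
  apply: (iu _ (A * C' - A' * C)); rewrite !rmorphB !rmorphM /=.
  transitivity (A%:~R * (A'%:~R * u ^+ 2 + B'%:~R * u + C'%:~R) -
    A'%:~R * (A%:~R * u ^+ 2 + B%:~R * u + C%:~R)); first by ring.
  by rewrite ru ru' !mulr0 subrr.
move/(congr1 (fun z : int => z%:~R : R)); rewrite rmorphB !rmorphM /= Bs Bs'.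
move=> AB; have : A%:~R * A'%:~R * (v - v') = 0.
  by transitivity (0%:~R : R) => //; rewrite -AB; ring.
move/eqP; rewrite mulf_eq0 mulf_eq0 !intr_eq0 (negbTE A0) (negbTE A0') /=.
by rewrite subr_eq0 => /eqP.
Qed.

(** The new coefficients come from putting x = a + e / y and clearing denominators; this
    substitution has determinant [- e], so the discriminant is kept. *)
Lemma conj_roots_inv_sub (R : realType) (D A B C a e : int) (u v : R) :
  e ^+ 2 = 1 -> u != a%:~R -> v != a%:~R -> conj_roots D A B C u v ->
  conj_roots D (A * a ^+ 2 + B * a + C) (e * (2 * A * a + B)) A
    (e%:~R / (u - a%:~R)) (e%:~R / (v - a%:~R)).
Proof.
move=> e2 ua va [DE ru rv uv].
have e2R : e%:~R ^+ 2 = 1 :> R by rewrite -rmorphXn /= e2.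
have root (x : R) : x != a%:~R -> A%:~R * x ^+ 2 + B%:~R * x + C%:~R = 0 ->
    (A * a ^+ 2 + B * a + C)%:~R * (e%:~R / (x - a%:~R)) ^+ 2 +
    (e * (2 * A * a + B))%:~R * (e%:~R / (x - a%:~R)) + A%:~R = 0.
  rewrite -subr_eq0 => xa rx.
  rewrite !(rmorphD, rmorphM) /=.
  (* The substitution yields [e ^+ 2 * A] as constant term; the second summand, which is zero,
     restores [A]. *)
  transitivity ((e%:~R ^+ 2 * (A%:~R * x ^+ 2 + B%:~R * x + C%:~R) +
     (1 - e%:~R ^+ 2) * A%:~R * (x - a%:~R) ^+ 2) / (x - a%:~R) ^+ 2).
    by field.
  by rewrite rx e2R subrr mulr0 !mul0r addr0 mul0r.
split; [|exact: root|exact: root|].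
  rewrite -DE exprMn e2 mul1r; ring.
have e0 : e%:~R != 0 :> R.
  by rewrite intr_eq0 -sqrf_eq0 e2.
apply: contraNneq uv => /(mulfI e0)/invr_inj.
by move/addIr => ->.
Qed.

(** * Joint dynamics of a number and its conjugate; periodic points are reduced *)

(** The second component is moved by the digits of the first, not by its own, so that conjugacy
    persists. *)
Definition ecf_pair (R : realType) (x : R * R) : R * R :=
  (T_E x.1, (ecf_sign x.1)%:~R / (x.2 - (ecf_digit x.1)%:~R)).

Lemma ecf_pair_iter1 (R : realType) (x : R * R) (i : nat) :
  (iter i (@ecf_pair R) x).1 = iter i (@T_E R) x.1.
Proof. by elim: i => //= i ->. Qed.

Lemma conj_roots_iter (R : realType) (D A B C : int) (x : R * R) (i : nat) :
  irrat x.1 -> 1 < x.1 -> D != 0 -> conj_roots D A B C x.1 x.2 ->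
  exists A' B' C', conj_roots D A' B' C'
    (iter i (@ecf_pair R) x).1 (iter i (@ecf_pair R) x).2.
Proof.
move=> ix x1 D0 h; elim: i => [|i [A' [B' [C' h']]]] /=; first by exists A, B, C.
have := (iter_T_E_irrat_gt1 i ix x1).1; rewrite -ecf_pair_iter1 => iy.
have iy2 := conj_roots_irrat iy D0 h'.
set y := iter i _ x in h' iy iy2 *; rewrite T_EE.
exists (A' * ecf_digit y.1 ^+ 2 + B' * ecf_digit y.1 + C').
exists (ecf_sign y.1 * (2 * A' * ecf_digit y.1 + B')), A'.
by apply: conj_roots_inv_sub; rewrite ?irrat_neq_int ?ecf_sign_sqr.
Qed.

Lemma norm_ecf_sign (R : realType) (u : R) : irrat u ->
  `|(ecf_sign u)%:~R| = 1 :> R.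
Proof.
move=> /ecf_sign_sqr/eqP; rewrite sqrf_eq1 => /orP[]/eqP ->.
  by rewrite normr1.
by rewrite rmorphN normrN normr1.
Qed.

Lemma ecf_pair_norm2 (R : realType) (x : R * R) : irrat x.1 ->
  `|(ecf_pair x).2| = `|x.2 - (ecf_digit x.1)%:~R|^-1.
Proof. by move=> ix; rewrite /ecf_pair /= normrM norm_ecf_sign // mul1r normfV. Qed.

(** The digit is at least 2. The sign of the difference matters as well as its size: it lets the
    image of [v] reveal [ecf_sign u]. *)
Lemma ecf_digit_sub_gt1 (R : realType) (u v : R) : 1 < u -> `|v| < 1 ->
  v - (ecf_digit u)%:~R < -1.
Proof.
move=> /ecf_digit_gt1; rewrite -(ler_int R) ltr_norml => a2 /andP[_ v1].
by have : 2 <= (ecf_digit u)%:~R :> R by []; lra.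
Qed.

Lemma ecf_pair_small (R : realType) (x : R * R) : irrat x.1 -> 1 < x.1 ->
  `|x.2| < 1 -> `|(ecf_pair x).2| < 1.
Proof.
move=> ix x1 x2; rewrite ecf_pair_norm2 //.
have h := ecf_digit_sub_gt1 x1 x2; have h1 : 1 < `|x.2 - (ecf_digit x.1)%:~R|.
  by rewrite ltr0_norm; lra.
by rewrite invf_lt1 // (lt_trans _ h1).
Qed.

(** The map divides the distance by [|x.1 - a| * |x.2 - a|]. The first factor is below 1 by the
    choice of digit, the second because the image of [x.2] has norm above 1. *)
Lemma ecf_pair_dist (R : realType) (x : R * R) : irrat x.1 -> irrat x.2 ->
  x.1 != x.2 -> 1 < `|(ecf_pair x).2| ->
  `|x.1 - x.2| < `|(ecf_pair x).1 - (ecf_pair x).2|.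
Proof.
move=> ix1 ix2 x12; rewrite ecf_pair_norm2 // /ecf_pair /= T_EE.
set a : R := (ecf_digit x.1)%:~R; set e : R := (ecf_sign x.1)%:~R => va.
have u0 : x.1 - a != 0 by rewrite subr_eq0 irrat_neq_int.
have v0 : x.2 - a != 0 by rewrite subr_eq0 irrat_neq_int.
have diff (c s t : R) : s - c != 0 -> t - c != 0 ->
    e / (s - c) - e / (t - c) = - e * (s - t) / ((s - c) * (t - c)).
  by move=> s0 t0; field; rewrite s0 t0.
rewrite diff //.
rewrite !normrM normrN norm_ecf_sign // mul1r normfV normrM.
rewrite ltr_pdivlMr ?mulr_gt0 ?normr_gt0 // gtr_pMr ?normr_gt0 ?subr_eq0 //.
have u1 : `|x.1 - a| < 1 by apply: ecf_digit_dist.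
have v1 : `|x.2 - a| < 1 by rewrite -[X in X < _]invrK invf_lt1 // (lt_trans _ va).
by rewrite mulr_ilt1.
Qed.

Lemma iter_fixed_mul (T : Type) (f : T -> T) (x : T) (n m : nat) :
  iter n f x = x -> iter (m * n) f x = x.
Proof. by move=> nx; elim: m => //= m IHm; rewrite mulSn iterD IHm. Qed.

Lemma T_E_periodic_conj (R : realType) (D A B C : int) (u v : R) (n : nat) :
  irrat u -> 1 < u -> D != 0 -> conj_roots D A B C u v ->
  (0 < n)%N -> iter n (@T_E R) u = u -> `|v| < 1.
Proof.
move=> iu u1 D0 h n0 nu.
pose x i := iter i (@ecf_pair R) (u, v).
have x1E i : (x i).1 = iter i (@T_E R) u by rewrite /x !ecf_pair_iter1.
have ix1 i : irrat (x i).1 by rewrite x1E; apply: (iter_T_E_irrat_gt1 i iu u1).1.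
have x11 i : 1 < (x i).1 by rewrite x1E; apply: (iter_T_E_irrat_gt1 i iu u1).2.
have hx i : exists A' B' C', conj_roots D A' B' C' (x i).1 (x i).2.
  exact: (conj_roots_iter (x := (u, v)) i iu u1 D0 h).
have ix2 i : irrat (x i).2.
  by have [A' [B' [C' h']]] := hx i; apply: conj_roots_irrat h'.
(* The conjugate of [u] is unique, so the whole pair has period [n]. *)
have xn : x n = (u, v).
  have [A' [B' [C']]] := hx n; rewrite x1E nu => h'.
  by rewrite [x n]surjective_pairing x1E nu -(conj_roots_uniq iu D0 D0 h h').
have small (i j : nat) : `|(x i).2| < 1 -> `|(x (i + j)%N).2| < 1.
  move=> xi; elim: j => [|j IHj];  first by rewrite addn0.
  rewrite addnS.
  exact: ecf_pair_small.
have [//|v1] := ltP `|v| 1.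
have big i : 1 < `|(x i).2|.
  have [xi|xi|xi] := ltgtP `|(x i).2| 1 => //; last first.
    have := irrat_neq_int 1 (ix2 i); have := irrat_neq_int (-1) (ix2 i).
    rewrite rmorphN /= => /eqP a1 /eqP a2.
    move/eqP: xi; rewrite eqr_norml => /andP[/orP[]/eqP e _].
      by case: a2; rewrite e.
    by case: a1; rewrite e.
  (* [i + i * n.-1 = i * n] is a multiple of the period, where the pair is back at [(u, v)]. *)
  have := small i (i * n.-1)%N xi.
  rewrite -mulnS prednK // /x iter_fixed_mul //= => v1'.
  by have := lt_le_trans v1' v1; rewrite ltxx.
have step i : `|(x i).1 - (x i).2| < `|(x i.+1).1 - (x i.+1).2|.
  have [A' [B' [C' [_ _ _ h']]]] := hx i.
  exact: ecf_pair_dist (ix1 i) (ix2 i) h' (big i.+1).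
have := homo_ltn lt_trans step n0.
by rewrite xn /= ltxx.
Qed.

(** * Finiteness for a given discriminant; reduced numbers are periodic *)

Lemma conj_roots_disc (R : realType) (D A B C : int) (u v : R) :
  conj_roots D A B C u v -> D%:~R = (A%:~R * (u - v)) ^+ 2.
Proof.
move=> h; have [<- _ _ _] := h; rewrite rmorphB !rmorphM /=.
by rewrite (conj_roots_sum h) (conj_roots_prod h); ring.
Qed.

(** The inequality says that A X^2 + B X + C takes values of opposite signs at 1 and -1, as happens
    when exactly one root lies between them. *)
Lemma reduced_disc_bound (A B C D : int) :
  B ^+ 2 - 4 * A * C = D -> (A + C) ^+ 2 < B ^+ 2 ->
  [/\ `|A| <= D, `|B| <= D & `|C| <= D].
Proof.
move=> DE ACB.
(* [B ^+ 2 - (A + C) ^+ 2 = D - (A - C) ^+ 2] *)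
have AC : (A - C) ^+ 2 < D by rewrite -DE; lia.
(* This sum times the positive integer [|B| - |A + C|] is at most [D]. *)
have h1 : `|B| + `|A + C| <= D.
  have : `|B| ^+ 2 - `|A + C| ^+ 2 <= D.
    rewrite !real_normK ?num_real //; have := sqr_ge0 (A - C); lia.
  have : `|A + C| < `|B|.
    by rewrite -ltr_sqr ?nnegrE // !real_normK ?num_real.
  have := normr_ge0 (A + C); nia.
have h2 : `|A - C| <= D.
  apply: le_trans (ltW AC); rewrite -[X in _ <= X]real_normK ?num_real //.
  have := normr_ge0 (A - C); nia.
by split; lia.
Qed.

Lemma conj_roots_bound (R : realType) (D A B C : int) (u v : R) :
  A != 0 -> 1 < u -> `|v| < 1 -> conj_roots D A B C u v ->
  [/\ `|A| <= D, `|B| <= D & `|C| <= D].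
Proof.
move=> A0 u1; rewrite ltr_norml => /andP[v1 v2] h; have [DE _ _ _] := h.
apply: (reduced_disc_bound DE).
rewrite -(ltr_int R) -subr_gt0 !rmorphXn rmorphD /=.
rewrite (conj_roots_sum h) (conj_roots_prod h).
have -> : (- (A%:~R * (u + v))) ^+ 2 - (A%:~R + A%:~R * (u * v)) ^+ 2 =
  A%:~R ^+ 2 * ((u - 1) * (u + 1)) * ((1 - v) * (1 + v)) by ring.
have A2 : 0 < A%:~R ^+ 2 :> R by rewrite exprn_even_gt0 //= intr_eq0.
by apply: mulr_gt0; [apply: mulr_gt0 => // |]; apply: mulr_gt0; lra.
Qed.

(** Equal sums and products give the same two roots, and only one of them exceeds 1. *)
Lemma conj_roots_inj (R : realType) (D A B C : int) (u v u' v' : R) :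
  A != 0 -> 1 < u -> 1 < u' -> `|v| < 1 -> `|v'| < 1 ->
  conj_roots D A B C u v -> conj_roots D A B C u' v' -> (u, v) = (u', v').
Proof.
move=> A0 u1 u1'; rewrite !ltr_norml => /andP[_ v1] /andP[_ v1'] h h'.
have A0R : A%:~R != 0 :> R by rewrite intr_eq0.
have : A%:~R * (u + v) = A%:~R * (u' + v').
  by apply: oppr_inj; rewrite -(conj_roots_sum h) (conj_roots_sum h').
move/(mulfI A0R) => sE.
have : A%:~R * (u * v) = A%:~R * (u' * v').
  by rewrite -(conj_roots_prod h) (conj_roots_prod h').
move/(mulfI A0R) => pE.
have : (u - u') * (u - v') = 0.
  transitivity (u * (u + v) - u * v - u * (u' + v') + u' * v'); first ring.
  by rewrite sE pE; ring.
move/eqP; rewrite mulf_eq0 !subr_eq0 => /orP[]/eqP uE.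
  by move: sE; rewrite uE => /addrI ->.
by move: v1'; rewrite -uE ltNge ltW.
Qed.

Lemma bounded_seq_collision (N : nat) (f : nat -> int * int * int) :
  (forall i, [/\ `|(f i).1.1| <= N%:Z, `|(f i).1.2| <= N%:Z &
                 `|(f i).2| <= N%:Z]) ->
  exists i j, (i < j)%N /\ f i = f j.
Proof.
move=> fN; pose T := 'I_(2 * N).+1.
(* Shifting by [N] moves [-N, N] to [0, 2N], the range on which [inord] is faithful. *)
pose c (z : int) : T := inord (absz (z + N%:Z)).
have c_inj z z' : `|z| <= N%:Z -> `|z'| <= N%:Z -> c z = c z' -> z = z'.
  move=> zN zN' /(congr1 val); rewrite /= !inordK; lia.
pose g (i : 'I_#|{: T * T * T}|.+1) := (c (f i).1.1, c (f i).1.2, c (f i).2).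
have /injectivePn[i [j ij]] : ~~ injectiveb g.
  by apply/negP => /injectiveP/leq_card; rewrite card_ord ltnn.
have [iA iB iC] := fN i; have [jA jB jC] := fN j.
move=> [/(c_inj _ _ iA jA) eA /(c_inj _ _ iB jB) eB /(c_inj _ _ iC jC) eC].
have fE : f i = f j.
  by rewrite [f i]surjective_pairing [(f i).1]surjective_pairing eA eB eC
             -!surjective_pairing.
case: (ltngtP i j) => [lt|lt|/val_inj/eqP]; [by exists i, j|by exists j, i|].
by rewrite (negbTE ij).
Qed.

(** Unlike [E_reduced], this mentions no polynomial or discriminant, so it passes along orbits by
    itself. *)
Definition ecf_reduced (R : realType) (x : R * R) : Prop :=
  [/\ irrat x.1, 1 < x.1 & `|x.2| < 1].

Lemma ecf_reduced_iter (R : realType) (x : R * R) (i : nat) :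
  ecf_reduced x -> ecf_reduced (iter i (@ecf_pair R) x).
Proof.
move=> rx; elim: i => //= i [ix x1 x2].
by split; [apply: T_E_irrat | apply: T_E_gt1 | apply: ecf_pair_small].
Qed.

(** Both [x.2 - a] and [y.2 - b] are negative, so equal images force equal signs; then
    [a - b = x.2 - y.2] is an even integer of size below 2, hence 0. *)
Lemma ecf_pair_inj (R : realType) (x y : R * R) :
  ecf_reduced x -> ecf_reduced y -> ecf_pair x = ecf_pair y -> x = y.
Proof.
move=> [ix x1 x2] [iy y1 y2]; rewrite /ecf_pair !T_EE => -[].
have := ecf_digit_sub_gt1 y1 y2; have := ecf_digit_sub_gt1 x1 x2.
have := norm_ecf_sign iy; have := norm_ecf_sign ix.
rewrite /ecf_digit; set k := Num.floor _; set l := Num.floor _.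
set e : R := (ecf_sign _)%:~R; set d : R := (ecf_sign _)%:~R.
set a : R := (2 * k)%:~R; set b : R := (2 * l)%:~R => e1 d1 xa yb E1 E2.
have ed : e = d.
  have e0 : e = d * ((x.2 - a) / (y.2 - b)).
    by rewrite mulrCA -E2 mulrC divfK // lt_eqF //; lra.
  have q0 : 0 < (x.2 - a) / (y.2 - b) by rewrite nmulr_rgt0 ?invr_lt0; lra.
  move: e1; rewrite {1}e0 normrM d1 mul1r gtr0_norm // => q1.
  by rewrite e0 q1 mulr1.
have d0 : d != 0 by rewrite -normr_gt0 d1.
move: E1 E2; rewrite ed => /(mulfI d0)/invr_inj E1 /(mulfI d0)/invr_inj E2.
have kl : k = l.
  apply: even_dist_lt2; rewrite -(ltr_int R) intr_norm rmorphB /=.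
  rewrite -/a -/b; move: x2 y2; rewrite !ltr_norml => /andP[? ?] /andP[? ?].
  by apply/andP; split; rewrite -[2%:~R]/(2 : R); lra.
move: E1 E2; rewrite /a /b kl => /addIr E1 /addIr E2.
by rewrite [x]surjective_pairing [y]surjective_pairing E1 E2.
Qed.

Lemma ecf_reduced_periodic (R : realType) (D A B C : int) (u v : R) :
  ecf_reduced (u, v) -> D != 0 -> conj_roots D A B C u v ->
  exists2 n : nat, (0 < n)%N & iter n (@T_E R) u = u.
Proof.
move=> r D0 h; have [iu u1 v1] := r.
pose x i := iter i (@ecf_pair R) (u, v).
have rx i : ecf_reduced (x i) by apply: ecf_reduced_iter.
have /choice[t tP] i : exists t : int * int * int,
    conj_roots D t.1.1 t.1.2 t.2 (x i).1 (x i).2.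
  have [A' [B' [C' h']]] := conj_roots_iter (x := (u, v)) i iu u1 D0 h.
  by exists (A', B', C').
have A0 i : (t i).1.1 != 0.
  by have [ix _ _] := rx i; apply: conj_roots_lead_neq0 (tP i).
(* The coefficients along the orbit are bounded by [D], so two orbit points share a polynomial and
   therefore coincide. *)
have [i [j [ij tE]]] : exists i j, (i < j)%N /\ t i = t j.
  apply: (@bounded_seq_collision `|D|%N) => i; have [_ x1 x2] := rx i.
  by have [] := conj_roots_bound (A0 i) x1 x2 (tP i); split; lia.
have xE : x i = x j.
  have [_ xi1 xi2] := rx i; have [_ xj1 xj2] := rx j.
  have := tP j; rewrite -tE => tPj.
  rewrite [x i]surjective_pairing [x j]surjective_pairing.
  exact: conj_roots_inj xi1 xj1 xi2 xj2 (tP i) tPj.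
exists (j - i)%N; first by rewrite subn_gt0.
(* Injectivity cancels the first [m] steps, which removes any preperiod. *)
have back m : x m = x (m + (j - i))%N -> x 0%N = x (j - i)%N.
  by elim: m => // m IHm; rewrite addSn => /(ecf_pair_inj (rx _) (rx _)).
have := back i; rewrite subnKC ?(ltnW ij) // => /(_ xE)/(congr1 fst).
by rewrite /x !ecf_pair_iter1.
Qed.

(** * Equivalence of reducedness, periodic expansion and periodicity under [T_E] *)

Theorem proposition14 (R : realType) (D : nat) (D_gt0 : (0 < D)%N)
    (D_nsq : forall m : nat, D <> (m ^ 2)%N) (w : R) (hw : qi_of_disc D w) :
  [<-> E_reduced D w;
       1 < w /\ (exists2 s : nat -> nat * int,
                   ecf_expansion w s & purely_periodic s);
       1 < w /\ (exists2 n : nat, (0 < n)%N & iter n (@T_E R) w = w)].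
Proof.
have [A [B [C [mp DE]]]] := hw; have [qw A_gt0 _ rw] := mp.
have iw := QI_irrat qw.
tfae.
- move=> [_ w1 [v [A' [B' [C' [[_ A'0 _ rw'] rv vw]]]] v1]]; split => //.
  (* The polynomial that witnesses the conjugate is kept with its own discriminant, which is nonzero
     as [v != w]; it is not compared with [A], [B], [C]. *)
  have h : conj_roots (B' ^+ 2 - 4 * A' * C') A' B' C' w v.
    by split => //; rewrite eq_sym.
  have D0 : B' ^+ 2 - 4 * A' * C' != 0.
    rewrite -(intr_eq0 R) (conj_roots_disc h) sqrf_eq0 mulf_eq0 intr_eq0.
    by rewrite subr_eq0 [w == v]eq_sym (negbTE vw) orbF gt_eqF.
  have [|n n0 nw] := ecf_reduced_periodic _ D0 h.
    by split => //=; rewrite ltr_norml.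
  exists (ecf_seq w); first exact: ecf_seq_expansion.
  by exists n => // i; rewrite /ecf_seq iterD nw.
- move=> [w1 [s ws [n n0 ns]]]; split => //; exists n => //.
  (* Periodic digits make the truncations from index [n] and from index 0 equal, so their limits,
     the [n]-th iterate and [w], agree. *)
  have cs := ecf_expansion_iter iw ws; have c0 := cs 0%N; have cn := cs n.
  have tn m k : ecf_trunc R s m (k + n) = ecf_trunc R s m k.
    by elim: m k => [|m IHm] k /=; rewrite ns // -addSn IHm.
  have tE : (fun m => ecf_trunc R s m n) = (fun m => ecf_trunc R s m 0%N).
    by apply/funext => m; rewrite -(tn m 0%N).
  rewrite tE in cn; exact: cvg_unique cn c0.
- move=> [w1 [n n0 nw]]; split => //.
  have A0R : A%:~R != 0 :> R by rewrite intr_eq0 gt_eqF.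
  (* The other root, by the formula for the sum of roots. *)
  pose v : R := - (B%:~R / A%:~R) - w.
  have rv : A%:~R * v ^+ 2 + B%:~R * v + C%:~R = 0.
    by rewrite -rw /v; field.
  have D0 : (D%:Z != 0) by rewrite -lt0n in D_gt0 *; lia.
  (* A double root would give [2 * A * w + B = 0], against irrationality. *)
  have vw : v != w.
    apply/eqP => vw; have /eqP : 2 * A = 0.
      apply: (iw _ B); rewrite rmorphM /=.
      transitivity (A%:~R * (w - v)); last by rewrite vw subrr mulr0.
      by rewrite /v; field.
    by rewrite mulf_eq0 /= gt_eqF.
  have h : conj_roots D A B C w v by split; rewrite // eq_sym.
  have := T_E_periodic_conj iw w1 D0 h n0 nw; rewrite ltr_norml => v1.
  by exists v => //; exists A, B, C.
Qed.
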